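(* The set $\operatorname{PD}(2,1)$ of all pairs $(n,k)$ of positive integers for which there exists a projective $2$-divisible binary linear $[n,k]$ code consists exactly of all pairs $(n,k)$ of positive integers satisfying $k+1\leq n\leq 2^k-1$ and $n\notin\{2^k-3,2^k-2\}$.
   Context: A binary linear $[n,k]$ code is a $k$-dimensional subspace of $\mathbb{F}_2^n$. It is $2$-divisible if every codeword has even Hamming weight. It is projective if the columns of a generating matrix are nonzero and pairwise distinct (equivalently, the dual code has minimum distance at least $3$). *)

(* Defs.v *)
From mathcomp Require Import all_boot all_order all_algebra.
Set Implicit Arguments.
Unset Strict Implicit.
Unset Printing Implicit Defensive.

Import GRing.Theory.
Local Open Scope ring_scope.

Definition hamming_weight (n : nat) (x : 'rV['F_2]_n) : nat :=
  #|[set i : 'I_n | x 0 i != 0]|.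

Definition divisible_code (d n : nat) (C : {vspace 'rV['F_2]_n}) : Prop :=
  forall x, x \in C -> (d %| hamming_weight x)%N.

(* The rows of a generating matrix form a basis of the code. *)
Definition generating_matrix (n k : nat) (C : {vspace 'rV['F_2]_n})
    (G : 'M['F_2]_(k, n)) : Prop :=
  row_free G /\ forall x : 'rV['F_2]_n, (x \in C) = (x <= G)%MS.

(* Changing the basis of C acts on the columns of G by an invertible map, so
   the condition does not depend on the chosen generating matrix. *)
Definition projective_code (n : nat) (C : {vspace 'rV['F_2]_n}) : Prop :=
  exists G : 'M['F_2]_(\dim C, n),
    [/\ generating_matrix C G,
        forall j, col j G != 0
      & injective (fun j => col j G)].

(* PD21 (n, k): first the length n, then the dimension k. *)
Definition PD21 (nk : nat * nat) : Prop :=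
  [/\ (0 < nk.1)%N, (0 < nk.2)%N
    & exists C : {vspace 'rV['F_2]_(nk.1)},
        [/\ \dim C = nk.2, divisible_code 2 C & projective_code C]].

(* Main.v *)
(** The columns of a generating matrix of a projective code of dimension [k]
form a spanning set [S] of nonzero vectors of F_2^k, and the code is
2-divisible iff [S] sums to zero.  The sum of all vectors vanishes for
[k >= 2], so the complement of [S] in the nonzero vectors also sums to zero,
which excludes complements of size 1 and 2; the lower bound on [n] holds since
the columns are dependent.
Conversely, while a zero-sum set has fewer than 2^(k-1) elements, one of its
elements [x] can be replaced by two new vectors [y] and [x + y].  Starting from
the unit vectors and their sum this gives all [n < 2^(k-1)]; starting from
[{a, b, a + b}] and taking complements it gives the larger [n], where spanning
is automatic because a hyperplane has only 2^(k-1) elements. *)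
Require Import Defs.
From mathcomp Require Import all_boot all_order all_algebra.
From mathcomp Require Import zify.

Section BinarySpace.
Set Implicit Arguments.
Unset Strict Implicit.
Import GRing.Theory.
Local Open Scope ring_scope.

(** * Arithmetic in characteristic 2 *)

Lemma F2_neq0 (a : 'F_2) : a != 0 -> a = 1.
Proof. by case: a => [[|[|?]]] //= ?; move=> _; apply: val_inj. Qed.

Lemma F2_addxx (a : 'F_2) : a + a = 0.
Proof. by apply: addrr_pchar2; apply: pchar_Fp. Qed.

Lemma F2_mx_addxx m n (A : 'M['F_2]_(m, n)) : A + A = 0.
Proof. by apply/matrixP => i j; rewrite !mxE F2_addxx. Qed.

Lemma F2_mx_addKx m n (A B : 'M['F_2]_(m, n)) : A + (A + B) = B.
Proof. by rewrite addrA F2_mx_addxx add0r. Qed.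

Lemma F2_sum_card (I : finType) (P : pred I) (f : I -> 'F_2) :
  \sum_(i | P i) f i = #|[set i | P i & f i != 0]|%:R.
Proof.
rewrite -sum1_card natr_sum (bigID (fun i => f i != 0)) /= addrC big1 ?add0r.
  by apply: eq_big => [i|i /andP[_ /F2_neq0]]; rewrite ?inE.
by move=> i /andP[_ /negPn/eqP].
Qed.

Lemma F2_natr_eq0 m : (m%:R == 0 :> 'F_2) = ~~ odd m.
Proof. by rewrite -(dvdn_pcharf (pchar_Fp (isT : prime 2))) dvdn2. Qed.

(** * Zero-sum and spanning sets of vectors *)

Lemma card_F2_cV k : #|{: 'cV['F_2]_k}| = (2 ^ k)%N.
Proof. by rewrite card_mx card_Fp // muln1. Qed.

Definition zero_sum k (S : {set 'cV['F_2]_k}) :=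
  0 \notin S /\ \sum_(v in S) v = 0.

(** Dual form of spanning: no nonzero linear functional vanishes on [S]. This matches row-freeness
    of a matrix whose columns are the elements of [S]. *)
Definition spanning k (S : {set 'cV['F_2]_k}) :=
  forall u : 'rV['F_2]_k, (forall v, v \in S -> u *m v = 0) -> u = 0.

(** Translation by a vector [e] with [u *m e] equal to 1 exchanges the hyperplane and its
    complement, so each is half of the space. *)
Lemma card_hyperplane k (u : 'rV['F_2]_k) :
  u != 0 -> #|[set v : 'cV['F_2]_k | u *m v == 0]| = (2 ^ k.-1)%N.
Proof.
case: k u => [|k] u u0; first by rewrite thinmx0 eqxx in u0.
have /rV0Pn[i ui] := u0; set H := [set v | _].
pose e : 'cV['F_2]_k.+1 := delta_mx i 0.
have uv (v : 'cV['F_2]_k.+1) : (u *m v == 0) = ((u *m v) 0 0 == 0).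
  apply/eqP/eqP => [->|h]; first by rewrite mxE.
  by apply/matrixP => a b; rewrite !ord1 h mxE.
have ue : (u *m e) 0 0 = 1 by rewrite -colE mxE (F2_neq0 ui).
have imH : [set e + v | v in H] = ~: H.
  apply/setP => v; rewrite !inE uv; apply/imsetP/idP => [[w]|h].
    by rewrite inE uv => /eqP w0 ->; rewrite mulmxDr mxE ue w0.
  exists (e + v); last by rewrite F2_mx_addKx.
  by rewrite inE uv mulmxDr mxE ue (F2_neq0 h) F2_addxx.
have := cardsC H; rewrite -imH card_imset; last exact: addrI.
by rewrite card_F2_cV addnn -mul2n expnS => /eqP; rewrite eqn_pmul2l // => /eqP.
Qed.

(** Coordinate [i] of the sum counts, modulo 2, the vectors off the hyperplane of vanishing [i]-th
    coordinate; there are 2^(k-1) of them, an even number once [k] is at least 2. *)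
Lemma sum_F2_cV k : (1 < k)%N -> \sum_(v : 'cV['F_2]_k) v = 0.
Proof.
case: k => [|[|k]] // _.
apply/colP => i; rewrite summxE F2_sum_card mxE; apply/eqP.
rewrite F2_natr_eq0.
pose u : 'rV['F_2]_k.+2 := delta_mx 0 i.
have u0 : u != 0 by apply/rV0Pn; exists i; rewrite mxE !eqxx.
rewrite (@eq_card _ _ (mem (~: [set v | u *m v == 0]))) => [|v].
  by rewrite cardsCs setCK card_hyperplane // card_F2_cV /= !expnS; lia.
rewrite !inE -rowE; congr (~~ _).
apply/eqP/eqP => [h|/matrixP/(_ 0 0)]; last by rewrite !mxE.
by apply/matrixP => a b; rewrite !ord1 !mxE h.
Qed.

Lemma zero_sum_complement k (S : {set 'cV['F_2]_k}) :
  (1 < k)%N -> zero_sum S -> zero_sum (~: (0 |: S)).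
Proof.
move=> k1 [S0 sS]; split; first by rewrite !inE eqxx.
have := sum_F2_cV k1; rewrite (bigID [in 0 |: S]) /= big_setU1 //= sS !add0r.
by apply: etrans; apply: eq_bigl => v; rewrite inE.
Qed.

Lemma card_zero_sum_complement k (S : {set 'cV['F_2]_k}) :
  0 \notin S -> #|~: (0 |: S)| = (2 ^ k - 1 - #|S|)%N.
Proof.
move=> S0; have := cardsC (0 |: S); rewrite cardsU1 S0 card_F2_cV => <-.
by rewrite -subnDA addKn.
Qed.

Lemma zero_sum_card_neq k (S : {set 'cV['F_2]_k}) :
  zero_sum S -> #|S| \notin [:: 1%N; 2%N].
Proof.
move=> [S0 sS]; rewrite !inE negb_or; apply/andP; split; apply/negP.
  move=> /cards1P[x eS]; move: S0 sS.
  by rewrite eS big_set1 inE => /eqP h /esym.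
move=> /cards2P[x [y [xy eS]]]; move: sS.
rewrite eS big_setU1 ?inE //= big_set1 => /(congr1 (+%R x)).
by rewrite F2_mx_addKx addr0 => yx; rewrite yx eqxx in xy.
Qed.

(** Otherwise [S] together with 0 would fit into a hyperplane, which is one element too small. *)
Lemma large_spanning k (S : {set 'cV['F_2]_k}) :
  0 \notin S -> (2 ^ k.-1 <= #|S|)%N -> spanning S.
Proof.
move=> S0 cS u uS; apply/eqP/negPn/negP => /card_hyperplane cH.
have /subset_leq_card : 0 |: S \subset [set v : 'cV['F_2]_k | u *m v == 0].
  apply/subsetP => v; rewrite !inE => /orP[/eqP->|/uS->]; last exact: eqxx.
  by rewrite mulmx0.
by rewrite cH cardsU1 S0 add1n ltnNge cS.
Qed.

(** * Construction of zero-sum sets of prescribed size *)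

Lemma zero_sum_extend k (S : {set 'cV['F_2]_k}) :
    zero_sum S -> (0 < #|S| < 2 ^ k.-1)%N ->
  exists S' : {set 'cV['F_2]_k},
    [/\ zero_sum S', #|S'| = #|S|.+1 & spanning S -> spanning S'].
Proof.
move=> [S0 sS] /andP[S_gt0 ltS]; have /card_gt0P[x xS] := S_gt0.
have x0 : x != 0 by apply: contraNneq S0 => <-.
(* A vector [y] outside both [A] and its translate [B] makes [y] and [x + y] nonzero and new. It
   exists because [A] and [B] share 0 and [x], so their union has at most 2(|S| + 1) - 2 < 2^k
   elements. *)
set A := 0 |: S; set B := [set x + v | v in A].
have cB : #|B| = #|A| by rewrite card_imset //; apply: addrI.
have cA : #|A| = #|S|.+1 by rewrite cardsU1 S0.
have /subset_leq_card : [set 0; x] \subset A :&: B.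
  apply/subsetP => v; rewrite !inE => /orP[]/eqP->; rewrite ?eqxx ?xS ?orbT /=.
    by apply/imsetP; exists x; rewrite ?F2_mx_addxx // !inE xS orbT.
  by apply/imsetP; exists 0; rewrite ?addr0 // !inE eqxx.
rewrite cards2 eq_sym x0 => cAB.
have k2 : (2 ^ k = 2 * 2 ^ k.-1)%N.
  have : (1 < 2 ^ k.-1)%N by apply: leq_ltn_trans ltS.
  by case: (k) => // k' _; rewrite -expnS.
have : (0 < #|~: (A :|: B)|)%N.
  have := cardsC (A :|: B); rewrite cardsU cB cA card_F2_cV k2.
  by lia.
case/card_gt0P => y; rewrite !inE !negb_or => /andP[/andP[y0 yS] yB].
set z := x + y.
have [z0 zS] : z != 0 /\ z \notin S.
  apply/andP; rewrite -negb_or -in_set1 -in_setU; apply: contra yB => zA.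
  by apply/imsetP; exists z; rewrite ?F2_mx_addKx.
have yz : y != z by rewrite -subr_eq0 opprD addrCA subrr addr0 oppr_eq0.
have yT : y \notin z |: S :\ x by rewrite !inE (negPf yz) (negPf yS) andbF.
have zT : z \notin S :\ x by rewrite !inE (negPf zS) andbF.
exists (y |: (z |: S :\ x)); split.
- split; first by rewrite !inE negb_or eq_sym y0 negb_or eq_sym z0 (negPf S0) andbF.
  rewrite !big_setU1 //= -[RHS]sS (big_setD1 x xS) /=.
  by rewrite addrA /z (addrC x) F2_mx_addKx.
- by rewrite !cardsU1 yT zT (cardsD1 x S) xS.
move=> spS u uS; apply: spS => v vS.
have [->|vx] := eqVneq v x; last by apply: uS; rewrite !inE vx vS !orbT.
have -> : x = y + z by rewrite /z (addrC x) F2_mx_addKx.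
by rewrite mulmxDr !uS ?addr0 // !inE eqxx ?orbT.
Qed.

Lemma zero_sum_grow k (S : {set 'cV['F_2]_k}) n :
    zero_sum S -> (0 < #|S|)%N -> (#|S| <= n <= 2 ^ k.-1)%N ->
  exists S' : {set 'cV['F_2]_k},
    [/\ zero_sum S', #|S'| = n & spanning S -> spanning S'].
Proof.
move=> zS S0 /andP[/subnKC <-]; elim: (n - _)%N => [|m IHm] lem.
  by exists S; rewrite addn0.
have [|S1 [zS1 cS1 spS1]] := IHm; first by lia.
have [|S2 [zS2 cS2 spS2]] := zero_sum_extend zS1; first by lia.
by exists S2; split=> //; [lia | move=> /spS1].
Qed.

Lemma exists_zero_sum_triple k :
  (1 < k)%N -> exists2 S : {set 'cV['F_2]_k}, zero_sum S & #|S| = 3.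
Proof.
case: k => [|[|k]] // _.
pose a : 'cV['F_2]_k.+2 := delta_mx 0 0.
pose b : 'cV['F_2]_k.+2 := delta_mx 1 0.
have a0 : a != 0 by apply/eqP => /colP/(_ 0); rewrite !mxE.
have b0 : b != 0 by apply/eqP => /colP/(_ 1); rewrite !mxE.
have ab : a != b by apply/eqP => /colP/(_ 0); rewrite !mxE.
have ac : a != a + b by rewrite -subr_eq0 opprD addrA subrr add0r oppr_eq0.
have bc : b != a + b by rewrite -subr_eq0 opprD addrCA subrr addr0 oppr_eq0.
have c0 : a + b != 0.
  by apply: contra_neq ab => h; rewrite -[b](F2_mx_addKx a) h addr0.
have aU : a \notin b |: [set a + b] by rewrite !inE negb_or ab.
have bU : b \notin [set a + b] by rewrite inE.
exists (a |: (b |: [set a + b])); last by rewrite !cardsU1 aU bU cards1.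
split; first by rewrite !inE !negb_or !(eq_sym 0) a0 b0.
by rewrite !big_setU1 //= big_set1 addrA F2_mx_addxx.
Qed.

Lemma exists_zero_sum_frame k : (1 < k)%N ->
  exists S : {set 'cV['F_2]_k}, [/\ zero_sum S, #|S| = k.+1 & spanning S].
Proof.
move=> k1; pose e i : 'cV['F_2]_k := delta_mx i 0.
pose E := [set e i | i : 'I_k]; pose s := \sum_i e i.
have e_inj : injective e.
  move=> i j /colP/(_ i); rewrite !mxE !eqxx andbT /=.
  by case: eqP.
have sE i : s i 0 = 1.
  rewrite summxE (bigD1 i) //= mxE !eqxx big1 ?addr0 // => j ji.
  by rewrite mxE eq_sym (negPf ji).
(* All coordinates of [s] are 1, whereas a unit vector has a zero coordinate because [k] exceeds
   1. *)
have sU : s \notin E.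
  apply/imsetP => -[i _ si].
  have [j ji] : exists j : 'I_k, j != i.
    apply/existsP; rewrite -negb_forall; apply/negP => /forallP h.
    have : (#|'I_k| <= #|pred1 i|)%N by apply/subset_leq_card/subsetP => j _; apply: h.
    by rewrite card1 card_ord; lia.
  by have := sE j; rewrite si mxE (negPf ji).
exists (s |: E); split; first split.
- rewrite !inE negb_or; apply/andP; split.
    by apply/eqP => /colP/(_ (Ordinal k1)); rewrite sE mxE.
  by apply/imsetP => -[i _ /colP/(_ i)]; rewrite !mxE !eqxx.
- rewrite big_setU1 //= big_imset /=; last by move=> ? ? _ _; apply: e_inj.
  exact: F2_mx_addxx.
- by rewrite cardsU1 sU card_imset // card_ord.
move=> u uS; apply/rowP => i; rewrite [RHS]mxE.
have /matrixP/(_ 0 0) : u *m e i = 0 by apply/uS/setU1P; right; apply: imset_f.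
by rewrite -colE !mxE.
Qed.

Lemma exists_spanning_zero_sum k n :
    (k + 1 <= n <= 2 ^ k - 1)%N -> n \notin [:: 2 ^ k - 3; 2 ^ k - 2]%N ->
  exists S : {set 'cV['F_2]_k}, [/\ zero_sum S, #|S| = n & spanning S].
Proof.
rewrite !inE => /andP[kn nk] nN.
have k1 : (1 < k)%N by case: k kn nk nN => [|[|k]]; rewrite ?expn0 ?expn1; lia.
have k2 : (2 ^ k = 2 * 2 ^ k.-1)%N by rewrite -expnS prednK //; lia.
case: (ltnP n (2 ^ k.-1)) => [ltn|len].
  have [S [zS cS spS]] := exists_zero_sum_frame k1.
  have [||S' [zS' cS' spS']] := zero_sum_grow (n := n) zS; [lia | lia |].
  by exists S'; split=> //; apply: spS'.
(* [T] is the future complement. The excluded values of [n] are those that would give it 2 or 1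
   elements, so its size is 0 or at least 3; it is below 2^(k-1) because [n] is at least 2^(k-1). *)
have [T zT cT] : exists2 T : {set 'cV['F_2]_k}, zero_sum T & #|T| = (2 ^ k - 1 - n)%N.
  have [nE|nE] := eqVneq n (2 ^ k - 1)%N.
    exists set0; first by split; rewrite ?inE // big_set0.
    by rewrite cards0 nE subnn.
  have [S zS cS] := exists_zero_sum_triple k1.
  have [||S' [zS' cS' _]] := zero_sum_grow (n := (2 ^ k - 1 - n)%N) zS; [lia | lia |].
  by exists S'.
have zC := zero_sum_complement k1 zT.
have cC : #|~: (0 |: T)| = n.
  by rewrite (card_zero_sum_complement (proj1 zT)) cT subKn.
exists (~: (0 |: T)); split=> //.
by apply: large_spanning; [exact: (proj1 zC) | rewrite cC].
Qed.

(** * Translation between codes and sets of columns *)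

Lemma hamming_weight_natr n (x : 'rV['F_2]_n) :
  (hamming_weight x)%:R = (x *m const_mx 1 : 'M_1) 0 0.
Proof.
rewrite mxE (eq_bigr (x 0)) => [|i _]; last by rewrite mxE mulr1.
by rewrite F2_sum_card; congr (_%:R); apply: eq_card => i; rewrite !inE.
Qed.

Lemma dvdn2_hamming_weight n (x : 'rV['F_2]_n) :
  (2 %| hamming_weight x)%N <-> x *m const_mx 1 = 0 :> 'M_1.
Proof.
rewrite dvdn2 -F2_natr_eq0 hamming_weight_natr; split=> [/eqP h|->].
  by apply/matrixP => i j; rewrite !ord1 h mxE.
by rewrite mxE.
Qed.

Lemma row_freeP0 (F : fieldType) k n (G : 'M[F]_(k, n)) :
  row_free G <-> forall u : 'rV_k, u *m G = 0 -> u = 0.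
Proof.
split=> [fG u uG|h].
  by apply: (row_free_inj fG); rewrite uG mul0mx.
rewrite -kermx_eq0; apply/eqP/row_matrixP => i; rewrite row0.
by apply: h; apply/sub_kermxP/row_sub.
Qed.

Lemma exists_row_space_code k n (G : 'M['F_2]_(k, n)) : row_free G ->
  exists2 C : {vspace 'rV['F_2]_n}, \dim C = k & generating_matrix C G.
Proof.
move=> fG; pose f : 'Hom('rV['F_2]_k, 'rV['F_2]_n) := linfun (mulmxr G).
exists (limg f).
  rewrite limg_dim_eq ?dimvf; first by rewrite /dim /= mul1n.
  apply/eqP; rewrite -subv0; apply/subvP => u; rewrite memv_cap memv_ker lfunE /=.
  by case/andP => _ /eqP uG; rewrite (proj1 (row_freeP0 G) fG _ uG) mem0v.
split=> // x; apply/memv_imgP/submxP => [[u _ ->]|[u ->]].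
  by exists u; rewrite lfunE.
by exists u; rewrite ?memvf // lfunE.
Qed.

(** Even weight means orthogonality to the all-ones vector, a linear condition, so testing the rows
    of [G] suffices. *)
Lemma PD21_matrixP n k :
  PD21 (n, k) <-> [/\ (0 < n)%N, (0 < k)%N & exists G : 'M['F_2]_(k, n),
    [/\ row_free G, G *m const_mx 1 = 0 :> 'cV_k,
        forall j, col j G != 0 & injective (fun j => col j G)]].
Proof.
split=> [[/= n0 k0 [C [dC divC [G [[fG GC] G0 Ginj]]]]]|[n0 k0 [G [fG G1 G0 Ginj]]]].
  split=> //; subst k; exists G; split=> //.
  apply/row_matrixP => i; rewrite row0 row_mul; apply/dvdn2_hamming_weight/divC.
  by rewrite GC row_sub.
split=> //=; have [C dC gC] := exists_row_space_code fG.
subst k; exists C; split=> //; last by exists G.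
move=> x; rewrite (proj2 gC) => /submxP[u ->].
by apply/dvdn2_hamming_weight; rewrite -mulmxA G1 mulmx0.
Qed.

Lemma PD21_setP n k :
  PD21 (n, k) <-> [/\ (0 < n)%N, (0 < k)%N & exists S : {set 'cV['F_2]_k},
    [/\ zero_sum S, #|S| = n & spanning S]].
Proof.
have mul1 m (G : 'M['F_2]_(k, m)) : G *m const_mx 1 = \sum_j col j G.
  apply/colP => i; rewrite mxE summxE; apply: eq_bigr => j _.
  by rewrite !mxE mulr1.
rewrite PD21_matrixP; split=> -[n0 k0].
  case=> G [fG G1 G0 Ginj]; split=> //; exists [set col j G | j : 'I_n]; split.
  - split; first by apply/imsetP => -[j _ /esym/eqP]; apply/negP.
    by rewrite big_imset /= -?mul1 // => ? ? _ _; apply: Ginj.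
  - by rewrite card_imset // card_ord.
  move=> u uS; apply: (proj1 (row_freeP0 G) fG); apply/matrixP => i j.
  have /matrixP/(_ i 0) := uS _ (imset_f (fun j => col j G) (isT : j \in 'I_n)).
  by rewrite colE mulmxA -colE !mxE.
case=> S [[S0 sS] cS spS]; split=> //; subst n.
(* The columns of [G] enumerate [S] without repetition. *)
pose G := \matrix_(i < k, j < #|S|) (enum_val j : 'cV['F_2]_k) i 0.
have colG j : col j G = enum_val j by apply/colP => i; rewrite !mxE.
exists G; split.
- apply/row_freeP0 => u uG; apply: spS => v vS.
  by rewrite -(enum_rankK_in vS vS) -colG colE mulmxA uG mul0mx.
- by rewrite mul1 -[RHS]sS [RHS]big_enum_val; apply: eq_bigr => j _; apply: colG.
- by move=> j; rewrite colG; apply: contraNneq S0 => <-; apply: enum_valP.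
by move=> i j; rewrite !colG; apply: enum_val_inj.
Qed.

(** The nonzero all-ones vector is killed by [G], so the rank [k] of [G] is less than [n]. *)
Lemma PD21_dim_lt n k : PD21 (n, k) -> (k < n)%N.
Proof.
move=> /PD21_matrixP[n0 k0 [G [fG G1 _ _]]].
have := mulmx0_rank_max G1; rewrite (eqP fG).
suff: (0 < \rank (const_mx 1%R : 'cV['F_2]_n))%N by lia.
rewrite lt0n mxrank_eq0; apply/eqP => /colP/(_ (Ordinal n0)).
by rewrite !mxE.
Qed.

End BinarySpace.

Theorem theorem5 (n k : nat) :
  PD21 (n, k) <->
  [/\ 0 < n, 0 < k, k + 1 <= n <= 2 ^ k - 1
    & n \notin [:: 2 ^ k - 3; 2 ^ k - 2]].
Proof.
split=> [PDnk|[n0 k0 nk nN]]; last first.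
  by apply/PD21_setP; split=> //; apply: exists_spanning_zero_sum.
have ltkn := PD21_dim_lt PDnk.
have [n0 k0 [S [zS cS _]]] := proj1 (PD21_setP n k) PDnk.
have S0 := proj1 zS.
have leS : n <= 2 ^ k - 1.
  by have := max_card (mem (0%R |: S)%SET); rewrite cardsU1 S0 card_F2_cV cS; lia.
have k1 : 1 < k by case: k k0 ltkn leS {PDnk S zS cS S0} => [|[|k]]; rewrite ?expn1; lia.
split=> //; first by lia.
(* The complement of [S] in the nonzero vectors has 2^k - 1 - n elements, which therefore cannot be
   1 or 2. *)
have := zero_sum_card_neq (zero_sum_complement k1 zS).
rewrite card_zero_sum_complement // cS !inE.
(* This keeps the subtractions in 2^k - 3 and 2^k - 2 from truncating at 0. *)
have : 2 ^ 2 <= 2 ^ k by rewrite leq_exp2l.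
by lia.
Qed.
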